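(* Let $\mathbf{a},\mathbf{b}:I\to\mathbb{R}^2$ be two smooth regular plane curves without inflection points. Then $\mathbf{a}$ and $\mathbf{b}$ are second order deformations of each other with respect to the special affine group if and only if the curve $\gamma_{(\mathbf{a},\mathbf{b})}=(a_1,-b_1,a_2,b_2):I\to\mathbb{R}^4$ is Lagrangian.
   Context: $I\subset\mathbb{R}$ is an interval. Without inflection points means $\det(\mathbf{a}',\mathbf{a}'')$ and $\det(\mathbf{b}',\mathbf{b}'')$ are nowhere zero. The special affine group is the semi-direct product of $\mathrm{SL}(2,\mathbb{R})$ with the translations of $\mathbb{R}^2$, acting on $\mathbb{R}^2$ by $\mathbf{x}\mapsto A\mathbf{x}+T$. For a Lie group $\mathcal{G}$ acting (smoothly, on the left) on $\mathbb{R}^2$ by $(g,\mathbf{x})\mapsto g\star\mathbf{x}$, two plane curves $\mathbf{a},\mathbf{b}:I\to\mathbb{R}^2$ are $k$-th order deformations of each other with respect to $\mathcal{G}$ if there exists a smooth map $g:I\to\mathcal{G}$ such that, for every $t_0\in I$, the curves $\mathbf{a}$ and $t\mapsto g(t_0)\star\mathbf{b}(t)$ have the same $k$-th order jet at $t_0$. A smooth curve $\gamma:I\to\mathbb{R}^4$ is Lagrangian if $\gamma'(t),\gamma''(t)$ are linearly independent and $\Lambda(\gamma'(t),\gamma''(t))=0$ for all $t$, where $\Lambda(X,Y)=x_1y_3+x_2y_4-x_3y_1-x_4y_2$. *)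

(* Defs.v *)
From HB Require Import structures.
From mathcomp Require Import all_boot all_order all_algebra.
From mathcomp Require Import all_classical all_reals all_analysis.

Set Implicit Arguments.
Unset Strict Implicit.
Unset Printing Implicit Defensive.

Import Order.TTheory GRing.Theory Num.Theory.
Import numFieldNormedType.Exports.

Local Open Scope classical_set_scope.
Local Open Scope ring_scope.

Section Smooth.
Variables (R : realType) (V : normedModType R) (I : set R).
Implicit Types (f h : R -> V) (t : R).

(* A map on the interval I is the restriction of a total function. Limits are
   taken within I, so derivatives are one-sided at the endpoints belonging to I
   and the values outside I play no role; at interior points this is the
   library derivative (lemma derive_on_interior). *)
Definition quotient_on f t : set_system V :=
  (s - t)^-1 *: (f s - f t) @[s --> within I t^'].

Definition derivable_on f := forall t, I t -> cvg (quotient_on f t).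

Definition derive_on f : R -> V := fun t => lim (quotient_on f t).

Definition nderive_on (n : nat) f : R -> V := iter n derive_on f.

Definition smooth_on f := forall n, derivable_on (nderive_on n f).

Definition same_jet (k : nat) (t : R) f h :=
  forall n, (n <= k)%N -> nderive_on n f t = nderive_on n h t.

Lemma quotient_on_interior f t : I° t ->
  quotient_on f t = (h^-1 *: (f (h + t) - f t) @[h --> 0^']).
Proof.
move=> It; rewrite funeqE => A; rewrite /quotient_on /= propeqE.
have It0 : \forall h \near (0 : R), I (h + t).
  by have := It; rewrite /interior /= [X in X -> _](near_shift 0 t) subr0.
rewrite !near_simpl /= !near_withinE.
rewrite [X in X <-> _](near_shift 0 t) subr0 /=.
split; apply: filter_app; near=> h => /=.
  move=> + h0; rewrite addrK; apply; last by near: h.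
  by apply: contraNneq h0 => /(canRL (addrK t)) ->; rewrite subrr.
move=> + h0 _; rewrite addrK; apply.
by apply: contraNneq h0 => ->; rewrite add0r.
Unshelve. all: by end_near. Qed.

Lemma derive_on_interior f t : I° t -> derive_on f t = derive1 f t.
Proof. by move=> It; rewrite /derive_on quotient_on_interior. Qed.

End Smooth.

(* A left action on the plane of a group that comes with an embedding in a
   normed space. This represents a Lie group G embedded as a closed
   submanifold of V: a map into G is smooth exactly when it is smooth as a map
   into V. The submanifold property and the smoothness of the operations are
   not recorded; special_affine_action below has both. *)
Record planar_action (R : realType) := PlanarAction {
  pa_group : groupType;
  pa_space : normedModType R;
  pa_embed : pa_group -> pa_space;
  pa_embed_inj : injective pa_embed;
  pa_act : pa_group -> 'cV[R]_2 -> 'cV[R]_2;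
  pa_act1 : forall x, pa_act 1%g x = x;
  pa_actM : forall g h x, pa_act (g * h)%g x = pa_act g (pa_act h x)
}.

Definition deformation (R : realType) (I : set R) (k : nat)
    (G : planar_action R) (a b : R -> 'cV[R]_2) :=
  exists2 g : R -> pa_group G,
    smooth_on I (fun t => pa_embed (g t)) &
    forall t0, I t0 -> same_jet I k t0 a (fun t => pa_act (g t0) (b t)).

Section SpecialAffine.
Variable R : realType.

Record special_affine := SpecialAffine {
  sa_pair : 'M[R]_2 * 'cV[R]_2;
  sa_det : \det sa_pair.1 == 1
}.

HB.instance Definition _ := [isSub for sa_pair].
HB.instance Definition _ := [Choice of special_affine by <:].

Implicit Types g h : special_affine.

Definition sa_mx g : 'M[R]_2 := (sa_pair g).1.
Definition sa_tr g : 'cV[R]_2 := (sa_pair g).2.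

Lemma det_sa_mx g : \det (sa_mx g) = 1. Proof. exact/eqP/sa_det. Qed.

Lemma sa_mx_unit g : sa_mx g \in unitmx.
Proof. by rewrite unitmxE det_sa_mx unitr1. Qed.

Fact sa_one_det : \det (1%:M : 'M[R]_2, 0 : 'cV[R]_2).1 == 1.
Proof. by rewrite det1. Qed.
Definition sa_one := SpecialAffine sa_one_det.

Fact sa_mul_det g h :
  \det (sa_mx g *m sa_mx h, sa_mx g *m sa_tr h + sa_tr g).1 == 1.
Proof. by rewrite det_mulmx !det_sa_mx mulr1. Qed.
Definition sa_mul g h := SpecialAffine (sa_mul_det g h).

Fact sa_inv_det g :
  \det (invmx (sa_mx g), - (invmx (sa_mx g) *m sa_tr g)).1 == 1.
Proof. by rewrite det_inv det_sa_mx invr1. Qed.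
Definition sa_inv g := SpecialAffine (sa_inv_det g).

Fact sa_mulA : associative sa_mul.
Proof.
move=> g h k; apply: val_inj => /=; rewrite /sa_mx /sa_tr /=.
by rewrite !mulmxA mulmxDr mulmxA addrA.
Qed.

Fact sa_mul1 : left_id sa_one sa_mul.
Proof.
move=> g; apply: val_inj => /=; rewrite /sa_mx /sa_tr /= !mul1mx addr0.
by case: (sa_pair g).
Qed.

Fact sa_mulr1 : right_id sa_one sa_mul.
Proof.
move=> g; apply: val_inj => /=; rewrite /sa_mx /sa_tr /= mulmx1 mulmx0 add0r.
by case: (sa_pair g).
Qed.

Fact sa_mulV : left_inverse sa_one sa_inv sa_mul.
Proof.
move=> g; apply: val_inj => /=.
by rewrite /sa_mx /sa_tr /= (mulVmx (sa_mx_unit g)) subrr.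
Qed.

Fact sa_mulrV : right_inverse sa_one sa_inv sa_mul.
Proof.
move=> g; apply: val_inj => /=.
rewrite /sa_mx /sa_tr /= (mulmxV (sa_mx_unit g)) mulmxN mulmxA.
by rewrite (mulmxV (sa_mx_unit g)) mul1mx addNr.
Qed.

HB.instance Definition _ := isGroup.Build special_affine
  sa_mulA sa_mul1 sa_mulr1 sa_mulV sa_mulrV.

Definition sa_act g (x : 'cV[R]_2) : 'cV[R]_2 := sa_mx g *m x + sa_tr g.

Fact sa_act1 x : sa_act 1%g x = x.
Proof. by rewrite /sa_act /sa_mx /sa_tr /= mul1mx addr0. Qed.

Fact sa_actM g h x : sa_act (g * h)%g x = sa_act g (sa_act h x).
Proof. by rewrite /sa_act {1}/sa_mx {2}/sa_tr /= mulmxDr mulmxA addrA. Qed.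

Definition special_affine_action : planar_action R :=
  @PlanarAction R special_affine ('M[R]_2 * 'cV[R]_2)%type
    sa_pair val_inj sa_act sa_act1 sa_actM.

End SpecialAffine.

Section Curves.
Variables (R : realType) (I : set R).

Definition det2 (u v : 'cV[R]_2) : R := \det (row_mx u v : 'M[R]_2).

Definition regular (c : R -> 'cV[R]_2) := forall t, I t -> derive_on I c t != 0.

Definition no_inflection (c : R -> 'cV[R]_2) :=
  forall t, I t -> det2 (derive_on I c t) (nderive_on I 2 c t) != 0.

(* Coordinates are numbered from 0. *)
Definition Lambda (X Y : 'cV[R]_4) : R :=
  X 0 0 * Y 2 0 + X 1 0 * Y 3 0 - X 2 0 * Y 0 0 - X 3 0 * Y 1 0.

Definition lagrangian (c : R -> 'cV[R]_4) :=
  smooth_on I c /\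
  forall t, I t -> free [:: derive_on I c t; nderive_on I 2 c t] /\
    Lambda (derive_on I c t) (nderive_on I 2 c t) = 0.

Definition gamma (a b : R -> 'cV[R]_2) (t : R) : 'cV[R]_4 :=
  \col_i [:: a t 0 0; - b t 0 0; a t 1 0; b t 1 0]`_i.

End Curves.

(* Main.v *)
Require Import Defs.
From mathcomp Require Import all_boot all_order all_algebra.
From mathcomp Require Import all_classical all_reals all_analysis.
From mathcomp Require Import ring lra.
Import Order.TTheory GRing.Theory Num.Theory.
Import numFieldNormedType.Exports.
Local Open Scope classical_set_scope.
Local Open Scope ring_scope.
Set Implicit Arguments.
Unset Strict Implicit.
Unset Printing Implicit Defensive.

(** Write [F_a = (a' | a'')] for the 2x2 matrix whose columns are the first two
derivatives of a plane curve. Both sides of the equivalence say that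
[det F_a = det F_b] on [I].

For the curve [gamma] this is a computation: differentiation acts on each
coordinate, so [gamma^(n)] is the [gamma] of [a^(n)] and [b^(n)]
(lemma [nderive_on_gamma]), and [Lambda (gamma', gamma'')] expands to
[det F_a - det F_b]. The linear independence of [gamma'] and [gamma''] comes for
free, because [a] already has no inflection point (lemma [lagrangian_gammaP]).

For deformations, let [g(t0)] have linear part [A] and translation part [T].
The second order contact of [a] and [A b + T] at [t0] means
[a(t0) = A b(t0) + T] and [F_a(t0) = A F_b(t0)]. Since [det A = 1], the second
equation forces the determinants to agree (lemma [deformation_frame]).
Conversely [F_b] is invertible, so the two equations have the unique solution
[A = F_a F_b^-1], [T = a - A b], and the equality of determinants says exactly
that [A] is in SL(2) (lemma [frame_deformation]).

What remains is that this [g] depends smoothly on [t0], which takes a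
differential calculus relative to [I]: derivatives are limits within [I], and
one-sided at its endpoints. All of it rests on lemma [nderive_on_seq]: a sequence
of functions, each a derivative of the previous one, witnesses that its first
term is smooth and lists the iterated derivatives. For products and inverses
such a sequence has no convenient closed form, and the set of all algebraic
expressions in smooth functions is used instead: it is stable under
differentiation, hence made of smooth functions (lemma [smooth_on_coind]). *)

(** * Determinants of pairs of plane vectors *)

Section PlaneDeterminant.
Context {R : realType}.
Implicit Types u v x y : 'cV[R]_2.

Lemma det_mx22 (M : 'M[R]_2) : \det M = M 0 0 * M 1 1 - M 0 1 * M 1 0.
Proof.
rewrite (expand_det_row _ 0) !big_ord_recl big_ord0 /cofactor !det_mx11 !mxE.
rewrite expr0 expr1 addr0 mul1r mulN1r mulrN.
have l0 : lift (0 : 'I_2) 0 = 1 by exact: val_inj.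
have l1 : lift (1 : 'I_2) 0 = 0 by exact: val_inj.
by rewrite -?[ord0]/(0) !l0 !l1.
Qed.

Lemma det2E u v : det2 u v = u 0 0 * v 1 0 - u 1 0 * v 0 0.
Proof.
have row0 k : row_mx u v k 0 = u k 0.
  by rewrite -(row_mxEl u v); congr (row_mx u v k _); exact: val_inj.
have row1 k : row_mx u v k 1 = v k 0.
  by rewrite -(row_mxEr u v); congr (row_mx u v k _); exact: val_inj.
by rewrite /det2 det_mx22 !row0 !row1 [v 0 0 * _]mulrC.
Qed.

Lemma det2_mulmx (A : 'M[R]_2) u v : det2 (A *m u) (A *m v) = \det A * det2 u v.
Proof. by rewrite /det2 -mul_mx_row; exact: det_mulmx. Qed.

(** The minus sign on the second coordinate of [gamma] is what turns the standard
symplectic form of R^4 into a difference of the two area forms. *)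
Lemma Lambda_gamma (x y u v : R -> 'cV[R]_2) t :
  Lambda (gamma x y t) (gamma u v t) = det2 (x t) (u t) - det2 (y t) (v t).
Proof. by rewrite /Lambda !mxE /= !det2E; ring. Qed.

(** A linear relation between the two vectors restricts to their first and third
coordinates, which carry the plane vectors [x t] and [u t]. *)
Lemma gamma_free (x y u v : R -> 'cV[R]_2) t :
  det2 (x t) (u t) != 0 -> free [:: gamma x y t; gamma u v t].
Proof.
rewrite det2E => xu0; rewrite free_cons span_seq1 seq1_free; apply/andP; split.
  apply: contra xu0 => /vlineP[k /matrixP gk].
  have := gk 0 0; have := gk 2 0; rewrite !mxE /= => -> ->.
  by apply/eqP; ring.
apply: contra xu0 => /eqP/matrixP g0.
have := g0 0 0; have := g0 2 0; rewrite !mxE /= => -> ->.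
by rewrite !mulr0 subrr.
Qed.

End PlaneDeterminant.

(** * Derivatives within an interval *)

Section CalculusWithin.
Context {R : realType} {I : set R}.
Hypotheses (I_interval : is_interval I) (I_nondegenerate : I° !=set0).
Implicit Types (t l df dg : R) (a b : R -> 'cV[R]_2).

Lemma nondegenerate_other t : exists2 c, I c & c != t.
Proof.
have [c Ic] := I_nondegenerate.
have [->|ct] := eqVneq t c; last first.
  by exists c; [exact: interior_subset|rewrite eq_sym].
have : c^' (fun s => I s /\ s != c).
  by apply: filterI; [exact: nbhs_dnbhs|exact: withinT].
by move=> /(@filter_ex _ c^')[s [Is sc]]; exists s.
Qed.

(** Properness is what makes limits within [I] unique. Some [c != t] lies in [I],
and by convexity [I] contains the whole segment from [t] to [c], which approaches
[t]. *)
Lemma within_dnbhs_proper t : I t -> ProperFilter (within I t^').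
Proof.
move=> It; apply: Build_ProperFilter_ex => P /= Pt.
have [c Ic ct] := nondegenerate_other t.
have cvgt : t + k * (c - t) @[k --> (0 : R)^'+] --> t.
  rewrite -[X in _ --> X]addr0 -[X in _ --> _ + X](mul0r (c - t)).
  apply: cvgD; first exact: cvg_cst.
  apply: cvgMl.
  exact: cvg_at_right_filter.
have near_t : \forall k \near (0 : R)^'+,
    t + k * (c - t) != t -> I (t + k * (c - t)) -> P (t + k * (c - t)).
  exact: (cvgt _ Pt).
near (0 : R)^'+ => k.
have Pk : t + k * (c - t) != t -> I (t + k * (c - t)) -> P (t + k * (c - t)).
  by near: k; exact: near_t.
have k0 : 0 < k by near: k; exact: nbhs_right_gt.
have k1 : k <= 1 by near: k; exact: nbhs_right_le.
exists (t + k * (c - t)); apply: Pk.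
  by rewrite addrC -subr_eq0 addrK; apply: mulf_neq0;
    [exact: lt0r_neq0|rewrite subr_eq0].
case: (ltgtP c t) ct => [ct|tc|//] _.
- by apply: (I_interval Ic It); apply/andP; split; nra.
- by apply: (I_interval It Ic); apply/andP; split; nra.
Unshelve. all: by end_near. Qed.

Lemma smooth_on_nderive {V : normedModType R} (f : R -> V) n :
  smooth_on I f -> smooth_on I (nderive_on I n f).
Proof. by move=> sf m; rewrite /nderive_on -iterD; exact: sf. Qed.

Arguments smooth_on_nderive {V f} n.

Lemma quotient_on_cst {V : normedModType R} (v : V) t :
  quotient_on I (fun=> v) t --> (0 : V).
Proof.
rewrite /quotient_on subrr.
under eq_fun do rewrite scaler0.
exact: cvg_cst.
Qed.

Lemma quotient_on_eq {V : normedModType R} (f g : R -> V) t :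
  {in I, f =1 g} -> I t -> quotient_on I f t = quotient_on I g t.
Proof.
move=> fg It; rewrite /quotient_on; apply/seteqP; split=> A;
  apply: near_eq_cvg; rewrite near_withinE; apply: nearW => s Is;
  by rewrite !fg ?inE.
Qed.

Lemma smooth_on_eq {V : normedModType R} (f g : R -> V) :
  {in I, f =1 g} -> smooth_on I f -> smooth_on I g.
Proof.
move=> fg sf n t It.
suff nfg : {in I, nderive_on I n f =1 nderive_on I n g}.
  by rewrite -(quotient_on_eq nfg It); exact: sf.
elim: n => [//|n IHn] s /set_mem Is.
by rewrite /= /derive_on (quotient_on_eq IHn Is).
Qed.

Lemma derive_onE {V : normedModType R} (f : R -> V) t (l : V) :
  I t -> quotient_on I f t --> l -> derive_on I f t = l.
Proof.
move=> It fl; have := within_dnbhs_proper It.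
by move=> ?; apply: cvg_lim fl; exact: norm_hausdorff.
Qed.

(** Exhibiting a candidate for every derivative gives smoothness and the values of
the derivatives at once; the hypothesis involves only one differentiation at a
time. *)
Lemma nderive_on_seq {V : normedModType R} (F : nat -> R -> V) :
  (forall n t, I t -> quotient_on I (F n) t --> F n.+1 t) ->
  smooth_on I (F 0) /\ forall n t, I t -> nderive_on I n (F 0) t = F n t.
Proof.
move=> dF.
have nF n : {in I, nderive_on I n (F 0) =1 F n}.
  elim: n => [//|n IHn] t /set_mem It /=.
  apply: derive_onE => //=; rewrite -/(nderive_on I n (F 0)).
  by rewrite (quotient_on_eq IHn It); exact: dF.
split=> [n t It|n t It]; last by apply: nF; rewrite inE.
rewrite (quotient_on_eq (nF n) It).
by apply/cvg_ex; exists (F n.+1 t); exact: dF.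
Qed.

(** The coinductive form of [nderive_on_seq]: when every member of a class has a
derivative in the class, dependent choice strings these derivatives into a
sequence. It serves when the derivatives have no simple closed formula. *)
Lemma smooth_on_coind {V : normedModType R} (C : (R -> V) -> Prop) :
  (forall f, C f ->
     exists2 g, C g & forall t, I t -> quotient_on I f t --> g t) ->
  forall f, C f -> smooth_on I f.
Proof.
move=> dC f Cf.
have step (h : {h | C h}) : exists k : {k | C k},
    forall t, I t -> quotient_on I (sval h) t --> sval k t.
  by case: h => h Ch; have [k Ck hk] := dC h Ch; exists (exist _ k Ck).
have [D dD] := choice step.
pose F n := sval (iter n D (exist _ f Cf)).
by have [] := @nderive_on_seq V F (fun n => dD _).
Qed.

(** * Rules of differentiation *)

Implicit Types f g : R -> R.

#[local] Instance within_dnbhs_filter t : Filter (within I t^') :=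
  within_filter I _.

Lemma cvg_within_eq {V : normedModType R} (f g : R -> V) t (l : V) :
  (forall s, I s -> s != t -> f s = g s) ->
  f s @[s --> within I t^'] --> l -> g s @[s --> within I t^'] --> l.
Proof.
move=> fg; apply: cvg_trans; apply: (@near_eq_cvg _ _ (within I t^')).
by rewrite !near_withinE; apply: nearW => s ? ?; exact: fg.
Qed.

(** Differentiability implies continuity: [f s] is [(s - t)] times the difference
quotient, plus [f t]. *)
Lemma quotient_on_continuous f t l :
  quotient_on I f t --> l -> f s @[s --> within I t^'] --> f t.
Proof.
move=> fl.
have st : s - t @[s --> within I t^'] --> (0 : R).
  rewrite -[X in _ --> X](subrr t); apply: cvgB; last exact: cvg_cst.
  by do 2 apply: cvg_within_filter; exact: cvg_id.
rewrite -[X in _ --> X](add0r (f t)) -[X in _ --> X + _](mul0r l).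
apply: (cvg_within_eq _ (cvgD (cvgM st fl) (cvg_cst (f t)))) => s _ sNt /=.
by rewrite /GRing.scale/= mulrA mulfV ?mul1r ?subrK// subr_eq0.
Qed.

Lemma quotient_onD {V : normedModType R} (f g : R -> V) t (df dg : V) :
  quotient_on I f t --> df -> quotient_on I g t --> dg ->
  quotient_on I (fun s => f s + g s) t --> df + dg.
Proof.
move=> fd gd; apply: (cvg_within_eq _ (cvgD fd gd)) => s _ _ /=.
by rewrite -scalerDr opprD addrACA.
Qed.

Lemma quotient_onN {V : normedModType R} (f : R -> V) t (df : V) :
  quotient_on I f t --> df -> quotient_on I (fun s => - f s) t --> - df.
Proof.
move=> fd; apply: (cvg_within_eq _ (cvgN fd)) => s _ _.
by rewrite /= -opprD scalerN.
Qed.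

(** The quotient of a product splits as
[q_f(s) g(t) + f(s) q_g(s)], with [q_f] and [q_g] the quotients of the factors. *)
Lemma quotient_onM f g t df dg :
  quotient_on I f t --> df -> quotient_on I g t --> dg ->
  quotient_on I (fun s => f s * g s) t --> df * g t + f t * dg.
Proof.
move=> fd gd.
have ft := quotient_on_continuous fd.
apply: (cvg_within_eq _ (cvgD (cvgM fd (cvg_cst (g t))) (cvgM ft gd))) => s _ _.
by rewrite /GRing.scale/=; ring.
Qed.

(** The quotient of [1 / f] is [- q_f(s) / (f(s) f(t))], with [q_f] the quotient of
[f]. The derivative is written without squares so that it is visibly a product of
[f'] and inverses of [f]. *)
Lemma quotient_onV f t df :
  (forall s, I s -> f s != 0) -> I t ->
  quotient_on I f t --> df ->
  quotient_on I (fun s => (f s)^-1) t --> - df * (f t)^-1 * (f t)^-1.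
Proof.
move=> f0 It fd.
have ft := quotient_on_continuous fd.
apply: (cvg_within_eq _
  (cvgM (cvgM (cvgN fd) (cvgV (f0 _ It) ft)) (cvg_cst (f t)^-1))) => s Is st /=.
rewrite fctE /unstable.inv_fun /GRing.scale/=.
by field; rewrite subr_eq0 st !f0.
Qed.

Lemma smooth_onD {V : normedModType R} (f g : R -> V) :
  smooth_on I f -> smooth_on I g -> smooth_on I (fun t => f t + g t).
Proof.
move=> sf sg; apply: (proj1 (nderive_on_seq
  (F := fun n t => nderive_on I n f t + nderive_on I n g t) _)) => n t It.
by apply: quotient_onD; [exact: sf|exact: sg].
Qed.

Lemma smooth_onN {V : normedModType R} (f : R -> V) :
  smooth_on I f -> smooth_on I (fun t => - f t).
Proof.
move=> sf; apply: (proj1 (nderive_on_seq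
  (F := fun n t => - nderive_on I n f t) _)) => n t It.
by apply: quotient_onN; exact: sf.
Qed.

(** The least class containing the smooth functions and closed under the algebraic
operations. Its induction principle computes a derivative inside the class by the
rules of differentiation; that its members are smooth is then a consequence,
obtained for all operations together. *)
Inductive smooth_algebra : (R -> R) -> Prop :=
| smooth_algebra_gen f of smooth_on I f : smooth_algebra f
| smooth_algebra_add f g of smooth_algebra f & smooth_algebra g :
    smooth_algebra (fun t => f t + g t)
| smooth_algebra_mul f g of smooth_algebra f & smooth_algebra g :
    smooth_algebra (fun t => f t * g t)
| smooth_algebra_inv f of smooth_algebra f & (forall t, I t -> f t != 0) :
    smooth_algebra (fun t => (f t)^-1).

Lemma smooth_on_cst {V : normedModType R} (v : V) : smooth_on I (fun=> v).
Proof.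
have [|//] := @nderive_on_seq V
  (fun n => if n is 0 then (fun=> v) else (fun=> 0)).
by case=> [|n] t It; exact: quotient_on_cst.
Qed.

(** The derivative of an algebraic expression in smooth functions is again such an
expression, so [smooth_on_coind] applies. *)
Lemma smooth_algebra_smooth f : smooth_algebra f -> smooth_on I f.
Proof.
apply: smooth_on_coind => // {}f.
elim=> {f} [f sf|f g sf [df sdf fd] sg [dg sdg gd]
  |f g sf [df sdf fd] sg [dg sdg gd]|f sf [df sdf fd] f0].
- exists (derive_on I f); last by move=> t; exact: (sf 0).
  by apply: smooth_algebra_gen; exact: (smooth_on_nderive 1).
- exists (fun t => df t + dg t); first exact: smooth_algebra_add.
  by move=> t It; apply: quotient_onD; [exact: fd|exact: gd].
- exists (fun t => df t * g t + f t * dg t).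
    by apply: smooth_algebra_add; exact: smooth_algebra_mul.
  by move=> t It; apply: quotient_onM; [exact: fd|exact: gd].
- exists (fun t => -1 * df t * (f t)^-1 * (f t)^-1).
    have sfV := smooth_algebra_inv sf f0.
    (* The sign of the derivative is a constant factor -1 of the product. *)
    do 3 apply: smooth_algebra_mul => //.
    exact/smooth_algebra_gen/smooth_on_cst.
  by move=> t It; rewrite mulN1r; apply: quotient_onV => //; exact: fd.
Qed.

Lemma smooth_onM f g : smooth_on I f -> smooth_on I g ->
  smooth_on I (fun t => f t * g t).
Proof.
by move=> sf sg; apply/smooth_algebra_smooth/smooth_algebra_mul;
  exact: smooth_algebra_gen.
Qed.

Lemma smooth_onV f : smooth_on I f -> (forall t, I t -> f t != 0) ->
  smooth_on I (fun t => (f t)^-1).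
Proof.
by move=> sf f0; apply/smooth_algebra_smooth/smooth_algebra_inv => //;
  exact: smooth_algebra_gen.
Qed.

Lemma smooth_on_sum (J : Type) (r : seq J) (P : pred J) (F : J -> R -> R) :
  (forall j, smooth_on I (F j)) ->
  smooth_on I (fun t => \sum_(j <- r | P j) F j t).
Proof.
move=> sF; elim: r => [|j r IHr].
  by under eq_fun do rewrite big_nil; exact: smooth_on_cst.
under eq_fun do rewrite big_cons.
by case: (P j); [exact: smooth_onD (sF j) IHr|exact: IHr].
Qed.

Lemma smooth_on_prod (J : Type) (r : seq J) (P : pred J) (F : J -> R -> R) :
  (forall j, smooth_on I (F j)) ->
  smooth_on I (fun t => \prod_(j <- r | P j) F j t).
Proof.
move=> sF; elim: r => [|j r IHr].
  by under eq_fun do rewrite big_nil; exact: smooth_on_cst.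
under eq_fun do rewrite big_cons.
by case: (P j); [exact: smooth_onM (sF j) IHr|exact: IHr].
Qed.

(** * Smooth matrices *)

Lemma cvg_mxP {T : Type} {m n : nat} (F : set_system T) (f : T -> 'M[R]_(m, n))
    (L : 'M[R]_(m, n)) : Filter F ->
  (forall i j, f x i j @[x --> F] --> L i j) <-> f x @[x --> F] --> L.
Proof.
move=> FF; split=> [fL|fL i j]; last first.
  exact: (cvg_comp f (fun M => M i j) fL (@coord_continuous _ _ _ i j L)).
apply/cvg_mx_entourageP => A entA; rewrite near_map.
apply: filter_forall => i; apply: filter_forall => j.
have : \forall x \near F, xsection A (L i j) (f x i j).
  by apply: (fL i j); exact: nbhs_entourage.
by apply: filterS => x /= /xsectionP; rewrite inE.
Qed.

Lemma quotient_on_mxP {m n : nat} (f : R -> 'M[R]_(m, n)) t (L : 'M[R]_(m, n)) :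
  (forall i j, quotient_on I (fun s => f s i j) t --> L i j) <->
  quotient_on I f t --> L.
Proof.
rewrite -cvg_mxP.
have E i j : (fun s => (s - t)^-1 *: (f s i j - f t i j)) =
    (fun s => ((s - t)^-1 *: (f s - f t)) i j).
  by apply/funext => s; rewrite !mxE.
by split=> fL i j; have := fL i j; rewrite /quotient_on E.
Qed.

Lemma quotient_on_mulmx {m n p : nat} (A : 'M[R]_(m, n))
    (f : R -> 'M[R]_(n, p)) t (df : 'M[R]_(n, p)) :
  quotient_on I f t --> df ->
  quotient_on I (fun s => A *m f s) t --> (A *m df : 'M[R]_(m, p)).
Proof.
move=> /quotient_on_mxP fd; apply/quotient_on_mxP => i j; rewrite mxE.
have sum_fd : (\sum_k A i k * ((s - t)^-1 *: (f s k j - f t k j)))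
    @[s --> within I t^'] --> \sum_k A i k * df k j.
  apply: cvg_big => [|k _]; first exact: add_continuous.
  by apply: cvgMr; exact: fd.
apply: cvg_within_eq sum_fd => s _ _; rewrite !mxE -sumrB scaler_sumr.
by apply: eq_bigr => k _; rewrite -mulrBr scalerAr.
Qed.

Lemma smooth_on_mx {m n : nat} (f : R -> 'M[R]_(m, n)) :
  (forall i j, smooth_on I (fun t => f t i j)) -> smooth_on I f.
Proof.
move=> sf.
pose F k t := \matrix_(i, j) nderive_on I k (fun s => f s i j) t.
have -> : f = F 0 by apply/funext => t; apply/matrixP => i j; rewrite mxE.
apply: (proj1 (nderive_on_seq _)) => k t It.
apply/quotient_on_mxP => i j; rewrite mxE.
under eq_fun do rewrite mxE.
exact: (sf i j k).
Qed.

Lemma smooth_on_coord {m n : nat} (f : R -> 'M[R]_(m, n)) i j :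
  smooth_on I f -> smooth_on I (fun t => f t i j).
Proof.
move=> sf; apply: (proj1 (nderive_on_seq
  (F := fun k t => nderive_on I k f t i j) _)) => k t It.
exact: (proj2 (quotient_on_mxP _ _ _)) (sf k t It) i j.
Qed.

Lemma smooth_on_row_mx {m n p : nat} (f : R -> 'M[R]_(m, n))
    (g : R -> 'M[R]_(m, p)) :
  smooth_on I f -> smooth_on I g -> smooth_on I (fun t => row_mx (f t) (g t)).
Proof.
move=> sf sg; apply: smooth_on_mx => i j; under eq_fun do rewrite mxE.
by case: (fintype.split j) => k; exact: smooth_on_coord.
Qed.

Lemma smooth_on_pair {V W : normedModType R} (f : R -> V) (g : R -> W) :
  smooth_on I f -> smooth_on I g -> smooth_on I (fun t => (f t, g t)).
Proof.
move=> sf sg.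
apply: (proj1 (@nderive_on_seq (V * W)%type
  (fun k t => (nderive_on I k f t, nderive_on I k g t)) _)) => k t It.
exact: (cvg_pair (sf k t It) (sg k t It)).
Qed.

Lemma smooth_on_mulmx {m n p : nat} (A : R -> 'M[R]_(m, n))
    (B : R -> 'M[R]_(n, p)) :
  smooth_on I A -> smooth_on I B -> smooth_on I (fun t => A t *m B t).
Proof.
move=> sA sB; apply: smooth_on_mx => i j.
under eq_fun do rewrite mxE.
apply: smooth_on_sum => k.
by apply: smooth_onM; exact: smooth_on_coord.
Qed.

(** The Leibniz formula is a polynomial in the entries. *)
Lemma smooth_on_det {n : nat} (A : R -> 'M[R]_n) :
  smooth_on I A -> smooth_on I (fun t => \det (A t)).
Proof.
move=> sA; apply: smooth_on_sum => s.
apply: smooth_onM; first exact: smooth_on_cst.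
by apply: smooth_on_prod => i; exact: smooth_on_coord.
Qed.

(** Cramer's rule: the inverse is the adjugate divided by the determinant. *)
Lemma smooth_on_invmx {n : nat} (A : R -> 'M[R]_n) :
  smooth_on I A -> (forall t, I t -> \det (A t) != 0) ->
  smooth_on I (fun t => invmx (A t)).
Proof.
move=> sA A0; apply: (@smooth_on_eq _ (fun t => (\det (A t))^-1 *: \adj (A t))).
  by move=> t /set_mem It; rewrite /invmx unitmxE unitfE A0.
apply: smooth_on_mx => i j; under eq_fun do rewrite !mxE.
apply: smooth_onM.
  by apply: smooth_onV => //; exact: smooth_on_det.
apply: smooth_onM; first exact: smooth_on_cst.
apply/smooth_on_det/smooth_on_mx => k l; under eq_fun do rewrite !mxE.
exact: smooth_on_coord.
Qed.

(** * Jets of the two curves *)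

Lemma nderive_on_gamma (a b : R -> 'cV[R]_2) :
  smooth_on I a -> smooth_on I b ->
  smooth_on I (gamma a b) /\ forall n t, I t ->
    nderive_on I n (gamma a b) t =
    gamma (nderive_on I n a) (nderive_on I n b) t.
Proof.
move=> sa sb; apply: (@nderive_on_seq _
  (fun n => gamma (nderive_on I n a) (nderive_on I n b))) => n t It.
apply/quotient_on_mxP => i j; rewrite mxE.
under eq_fun do rewrite mxE.
have da k := proj2 (quotient_on_mxP _ _ _) (sa n t It) k 0.
have db k := proj2 (quotient_on_mxP _ _ _) (sb n t It) k 0.
case: i => -[|[|[|[|//]]]] ? /=.
- exact: (da 0).
- exact: (quotient_onN (db 0)).
- exact: (da 1).
- exact: (db 1).
Qed.

Lemma nderive_on_affine {m n p : nat} (A : 'M[R]_(m, n)) (T : 'M[R]_(m, p))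
    (f : R -> 'M[R]_(n, p)) k t :
  smooth_on I f -> I t ->
  nderive_on I k.+1 (fun s => A *m f s + T) t = A *m nderive_on I k.+1 f t.
Proof.
move=> sf It.
have [|_ ->//] := @nderive_on_seq _
  (fun r s => A *m nderive_on I r f s + (if r is 0 then T else 0)); last first.
  by rewrite addr0.
move=> r s Is; apply: quotient_onD.
  by apply: quotient_on_mulmx; exact: sf.
by case: r => [|r]; exact: quotient_on_cst.
Qed.

Definition frame a t : 'M[R]_2 :=
  row_mx (derive_on I a t) (nderive_on I 2 a t).

Lemma smooth_on_frame a : smooth_on I a -> smooth_on I (frame a).
Proof.
move=> sa; exact: (@smooth_on_row_mx 2 1 1 _ _
  (smooth_on_nderive 1 sa) (smooth_on_nderive 2 sa)).
Qed.

(** [Lambda (gamma', gamma'')] is the difference of the two determinants, and the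
independence of [gamma'] and [gamma''] is inherited from [a'] and [a'']. *)
Lemma lagrangian_gammaP a b :
  smooth_on I a -> smooth_on I b -> no_inflection I a ->
  lagrangian I (gamma a b) <->
  forall t, I t -> \det (frame a t) = \det (frame b t).
Proof.
move=> sa sb a0.
have [sg dg] := nderive_on_gamma sa sb.
have d1 t : I t -> derive_on I (gamma a b) t =
    gamma (derive_on I a) (derive_on I b) t by exact: (dg 1).
have LE t : I t ->
    Lambda (derive_on I (gamma a b) t) (nderive_on I 2 (gamma a b) t) =
    \det (frame a t) - \det (frame b t).
  by move=> It; rewrite d1// dg// Lambda_gamma.
split=> [[_ lag] t It|ab].
  by have [_] := lag t It; rewrite (LE t It); exact: subr0_eq.
split=> [|t It]; first exact: sg.
split; last by rewrite (LE t It); apply/eqP; rewrite subr_eq0; apply/eqP/ab.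
by rewrite d1// dg//; apply: gamma_free; exact: a0.
Qed.

(** The translation part disappears on differentiation, so contact of order two
gives [F_a = A F_b] with [det A = 1]. *)
Lemma deformation_frame a b :
  smooth_on I b ->
  deformation I 2 (special_affine_action R) a b ->
  forall t, I t -> \det (frame a t) = \det (frame b t).
Proof.
move=> sb [g _ jet] t It.
have da n : (n < 2)%N ->
    nderive_on I n.+1 a t = sa_mx (g t) *m nderive_on I n.+1 b t.
  move=> n2; rewrite (jet t It n.+1 n2) /=.
  exact: nderive_on_affine.
rewrite /frame -[derive_on I a t]/(nderive_on I 1 a t) !da//.
by rewrite -/(det2 _ _) det2_mulmx det_sa_mx mul1r.
Qed.

(** Contact of order two determines the affine map: its linear part carries the
frame of [b] to that of [a], and its translation part then matches the points. *)
Lemma frame_deformation a b :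
  smooth_on I a -> smooth_on I b -> no_inflection I b ->
  (forall t, I t -> \det (frame a t) = \det (frame b t)) ->
  deformation I 2 (special_affine_action R) a b.
Proof.
move=> sa sb b0 ab.
pose A t := frame a t *m invmx (frame b t).
pose T t := a t - A t *m b t.
have sA : smooth_on I A.
  apply: (smooth_on_mulmx (smooth_on_frame sa)).
  exact: (smooth_on_invmx (smooth_on_frame sb)).
have sT : smooth_on I T.
  by apply: (smooth_onD sa); apply: smooth_onN; exact: smooth_on_mulmx.
have ub t : I t -> frame b t \in unitmx.
  by move=> It; rewrite unitmxE unitfE; exact: b0.
have detA t : I t -> \det (A t) == 1.
  move=> It; rewrite det_mulmx det_inv; apply/eqP.
  by apply: (canLR (mulfK (b0 t It))); rewrite mul1r; exact: ab.
(* Off [I] the determinant of [A t] need not be 1; there the map takes the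
   identity as its value, which does not affect smoothness on [I]. *)
pose g t : special_affine R := insubd (sa_one R) (A t, T t).
have gE t : I t -> sa_pair (g t) = (A t, T t).
  by move=> It; apply: insubdK; exact: detA.
exists g.
  apply: smooth_on_eq (smooth_on_pair sA sT).
  by move=> t /set_mem It; rewrite /= gE.
move=> t It n n2.
have -> : (fun s => pa_act (g t : pa_group (special_affine_action R)) (b s)) =
    (fun s => A t *m b s + T t).
  by apply/funext => s; rewrite /= /sa_act /sa_mx /sa_tr gE.
case: n n2 => [_|n n2]; first by rewrite /= /T addrC subrK.
rewrite nderive_on_affine//.
have : row_mx (A t *m derive_on I b t) (A t *m nderive_on I 2 b t) =
    row_mx (derive_on I a t) (nderive_on I 2 a t).
  by rewrite -mul_mx_row; exact: (mulmxKV (ub t It)).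
move=> /eq_row_mx[Ab1 Ab2].
case: n n2 => [_|[_|n n2]]; [exact: esym Ab1|exact: esym Ab2|exfalso].
exact: notF n2.
Qed.

End CalculusWithin.

Theorem proposition2p12 (R : realType) (I : set R)
    (I_interval : is_interval I) (I_nondegenerate : I° !=set0)
    (a b : R -> 'cV[R]_2)
    (a_smooth : smooth_on I a) (b_smooth : smooth_on I b)
    (a_regular : regular I a) (b_regular : regular I b)
    (a_no_inflection : no_inflection I a)
    (b_no_inflection : no_inflection I b) :
  deformation I 2 (special_affine_action R) a b <-> lagrangian I (gamma a b).
Proof.
have gammaP := lagrangian_gammaP I_interval I_nondegenerate
  a_smooth b_smooth a_no_inflection.
split=> [ab|/gammaP ab].
  exact/gammaP/(deformation_frame I_interval I_nondegenerate b_smooth ab).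
exact: (frame_deformation I_interval I_nondegenerate
  a_smooth b_smooth b_no_inflection ab).
Qed.
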